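(* Let $n \ge 1$ and let $(A, \overline A)$ be a partition of the sphere $S^n$ into two measurable sets, with measure density functions of distance $st_A$ and $st_{\overline A}$. Then $|st_A - st_{\overline A}|$ depends only on the difference of the $n$-areas of $A$ and $\overline A$. That is, if $(A,\overline A)$ and $(B,\overline B)$ are any two partitions of $S^n$ into two measurable sets with $\mu(A) - \mu(\overline A) = \mu(B) - \mu(\overline B)$, then $|st_A - st_{\overline A}| = |st_B - st_{\overline B}|$.
   Context: $S^n \subset \mathbb{R}^{n+1}$ is the sphere of unit radius, $\mu$ is its $n$-dimensional surface measure ($n$-area), and $d_E$ is the Euclidean distance of $\mathbb{R}^{n+1}$ restricted to $S^n$. $H$ is the Heaviside function, $H(x)=1$ for $x>0$ and $H(x)=0$ otherwise. For a measurable set $A \subset S^n$, the cumulative measure function of distance is $St_A(\ell) = \int_A d\mu(x) \int_A d\mu(y)\, H(\ell - d_E(x,y))$, and the measure density function of distance $st_A$ is its derivative with respect to $\ell$, i.e. $st_A(\ell) = \int_A d\mu(x)\int_A d\mu(y)\, \delta(\ell - d_E(x,y))$ with $\delta$ the Dirac delta. It is understood as a density on the line of distances (defined almost everywhere), so that $st_A = st_B$ is equivalent to $St_A = St_B$. These functions are not normalized: the total mass of $st_A$ is $\mu(A)^2$. *)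

(* Defs.v *)
From HB Require Import structures.
From mathcomp Require Import all_boot all_order all_algebra.
From mathcomp Require Import all_classical all_reals all_analysis.

Set Implicit Arguments.
Unset Strict Implicit.
Unset Printing Implicit Defensive.
Import Order.TTheory GRing.Theory Num.Theory.
Import numFieldNormedType.Exports.

Local Open Scope classical_set_scope.
Local Open Scope ring_scope.

(* Volume of the unit ball of R^n, via V_(n+2) = 2 pi / (n + 2) * V_n. *)
Fixpoint ball_volume (R : realType) (n : nat) : R :=
  match n with
  | 0 => 1
  | 1 => 2
  | m.+2 => 2 * pi / m.+2%:R * ball_volume R m
  end.

Lemma ball_volume_ge0 (R : realType) n : 0 <= ball_volume R n.
Proof.
suff: 0 <= ball_volume R n /\ 0 <= ball_volume R n.+1 by case.
elim: n => [|n [IH1 IH2]]; first by split=> /=.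
split=> //; rewrite [ball_volume _ _]/= mulr_ge0//.
by rewrite divr_ge0// mulr_ge0// pi_ge0.
Qed.

(* The n-dimensional Hausdorff measure of T for the distance d, normalized so
   that it agrees with the Lebesgue measure on R^n: the limit (supremum) as
   delta decreases to 0 of the infimum, over the countable covers of A by sets
   of diameter at most delta, of the sum of V_n (diam / 2)^n, where V_n is the
   volume of the unit ball of R^n. *)
Section hausdorff.
Context (R : realType) (T : Type) (d : T -> T -> R) (n : nat).
Local Open Scope ereal_scope.

(* -oo on the empty set *)
Definition diam (U : set T) : \bar R :=
  ereal_sup [set (d x y)%:E | x in U & y in U].

(* The empty set has weight 0 even when n = 0. Only nonempty sets of diameter
   at most delta matter: [fine] is then harmless, and so is the absolute value
   (which only serves to have nonnegative weights without assuming 0 <= d). *)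
Definition hausdorff_weight (U : set T) : \bar R :=
  if U == set0 then 0
  else (ball_volume R n * (`|fine (diam U)| / 2) ^+ n)%:E.

Definition hausdorff_cover (delta : R) (A : set T) : set (set T)^nat :=
  [set F | (forall k, diam (F k) <= delta%:E) /\ A `<=` \bigcup_k F k].

Definition hausdorff_content (delta : R) (A : set T) : \bar R :=
  ereal_inf [set \sum_(k <oo) hausdorff_weight (F k)
            | F in hausdorff_cover delta A].

Definition hausdorff (A : set T) : \bar R :=
  ereal_sup [set hausdorff_content delta A | delta in [set e : R | (0 < e)%R]].

Lemma hausdorff_weight_ge0 U : 0 <= hausdorff_weight U.
Proof.
rewrite /hausdorff_weight; case: ifPn => // _.
by rewrite lee_fin mulr_ge0// ?ball_volume_ge0// exprn_ge0// divr_ge0.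
Qed.

Lemma hausdorff_content_ge0 delta A : 0 <= hausdorff_content delta A.
Proof.
apply: le_ereal_inf_tmp => _ [F _ <-].
by apply: nneseries_ge0 => k _ _; exact: hausdorff_weight_ge0.
Qed.

Lemma le_hausdorff_content delta :
  {homo hausdorff_content delta : A B / A `<=` B >-> A <= B}.
Proof.
move=> A B AB; apply/ereal_inf_le_tmp => _ [F [dF BF] <-].
by exists F => //; split=> //; exact: subset_trans BF.
Qed.

Lemma hausdorff_content0 delta : hausdorff_content delta set0 = 0.
Proof.
apply/eqP; rewrite eq_le hausdorff_content_ge0 andbT.
apply: ereal_inf_lbound; exists (fun=> set0).
  split=> // k; rewrite /diam (_ : [set _ | _ in _ & _ in _] = set0).
    by rewrite ereal_sup0 leNye.
  by apply/seteqP; split=> // y [].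
by rewrite eseries0// => k _ _; rewrite /hausdorff_weight eqxx.
Qed.

Lemma hausdorff_content_sigma_subadditive delta :
  sigma_subadditive (hausdorff_content delta).
Proof.
move=> A.
have [[i ioo]|] := pselect (exists i, hausdorff_content delta (A i) = +oo).
  rewrite (eseries_pinfty _ _ ioo) ?leey// => k _.
  by rewrite -ltNye (lt_le_trans _ (hausdorff_content_ge0 _ _)).
rewrite -forallNE => Aoo.
apply/lee_addgt0Pr => e e0.
apply: le_trans (epsilon_trick xpredT
  (fun k => hausdorff_content_ge0 delta (A k)) (ltW e0)).
pose P k (B : (set T)^nat) := hausdorff_cover delta (A k) B /\
  \sum_(j <oo) hausdorff_weight (B j) <=
    hausdorff_content delta (A k) + (e / (2 ^ k.+1)%:R)%:E.
have [G PG] : {G : ((set T)^nat)^nat & forall k, P k (G k)}.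
  apply: (@choice _ _ P) => k.
  have fk : hausdorff_content delta (A k) \is a fin_num.
    rewrite ge0_fin_numE ?hausdorff_content_ge0// ltey.
    exact/eqP/Aoo.
  have ek : (0 < e / (2 ^ k.+1)%:R)%R by rewrite divr_gt0// ltr0n expn_gt0.
  have [_ [B cB <-] muB] := lb_ereal_inf_adherent ek fk.
  by exists B; split=> //; exact: ltW.
have G_ge0 x : 0 <= (hausdorff_weight \o uncurry G) x.
  exact: hausdorff_weight_ge0.
apply: (@le_trans _ _
    (\esum_(i in setT) (hausdorff_weight \o uncurry G) i)).
  apply: ereal_inf_lbound => /=.
  have /card_esym/ppcard_eqP[f] := card_nat2.
  exists (uncurry G \o f).
    split=> [i|]; first by rewrite /=; case: (f i) => a b; exact: (PG a).1.1.
    move=> t [i _ /((PG i).1.2)[j _ Gijt]].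
    by exists (f^-1%FUN (i, j)) => //=; rewrite invK ?inE.
  rewrite -(esum_pred_image (hausdorff_weight \o uncurry G) _ xpredT)
    ?[fun=> _]set_true//.
  by rewrite image_eq.
rewrite (_ : esum _ _ = \sum_(i <oo) \sum_(j <oo) hausdorff_weight (G i j));
  last first.
  pose J : nat -> set (nat * nat) := fun i => [set (i, j) | j in setT].
  rewrite (_ : setT = \bigcup_k J k); last first.
    by rewrite predeqE => -[a b]; split=> // _; exists a => //; exists b.
  rewrite esum_bigcupT //=; last first.
    apply/trivIsetP => i j _ _ ij.
    rewrite predeqE => -[k m] /=; split=> //= -[] [_] _ [<-{k} _].
    by move=> [m' _] [] /esym/eqP; rewrite (negbTE ij).
  rewrite -(image_id [set: nat]) -fun_true esum_pred_image//; last first.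
    by move=> k _; apply: esum_ge0 => x _; exact: G_ge0.
  apply: eq_eseriesr => /= j _.
  rewrite -(esum_pred_image (hausdorff_weight \o uncurry G) (pair j) predT)/=;
    [|by move=> k _; exact: hausdorff_weight_ge0
     |by move=> ? ? _ _; exact: (@can_inj _ _ _ snd)].
  by congr esum; rewrite predeqE => -[a b]; split; move=> [i _ <-]; exists i.
apply: lee_nneseries => [i _ _|i _]; last exact: (PG i).2.
by apply: nneseries_ge0 => j _ _; exact: hausdorff_weight_ge0.
Qed.

Lemma hausdorff_ge0 A : 0 <= hausdorff A.
Proof.
apply: (le_trans (hausdorff_content_ge0 1 A)).
by apply: ereal_sup_ubound; exists 1%R => //=.
Qed.

Lemma hausdorff0 : hausdorff set0 = 0.
Proof.
apply/eqP; rewrite eq_le hausdorff_ge0 andbT.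
by apply: ge_ereal_sup => _ [delta _ <-]; rewrite hausdorff_content0.
Qed.

Lemma le_hausdorff : {homo hausdorff : A B / A `<=` B >-> A <= B}.
Proof.
move=> A B AB; apply: ge_ereal_sup => _ [delta delta0 <-].
apply: (le_trans (le_hausdorff_content delta AB)).
by apply: ereal_sup_ubound; exists delta.
Qed.

Lemma hausdorff_sigma_subadditive : sigma_subadditive hausdorff.
Proof.
move=> A; apply: ge_ereal_sup => _ [delta delta0 <-].
apply: (le_trans (hausdorff_content_sigma_subadditive delta A)).
apply: lee_nneseries => [i _ _|i _]; first exact: hausdorff_content_ge0.
by apply: ereal_sup_ubound; exists delta.
Qed.

HB.instance Definition _ := isOuterMeasure.Build R T hausdorff
  hausdorff0 hausdorff_ge0 le_hausdorff hausdorff_sigma_subadditive.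

End hausdorff.

Definition dE (R : realType) (m : nat) (x y : 'rV[R]_m) : R :=
  Num.sqrt (\sum_(i < m) (x ord0 i - y ord0 i) ^+ 2).

Definition sphere (R : realType) (n : nat) : set 'rV[R]_n.+1 :=
  [set x | dE x 0 = 1].

Definition hausdorff_dE (R : realType) (n : nat) :
    {outer_measure set 'rV[R]_n.+1 -> \bar R} :=
  hausdorff (@dE R n.+1) n.

(* R^(n+1) with the sigma-algebra of Caratheodory-measurable sets of the
   n-dimensional Hausdorff measure; on subsets of the sphere S^n, [n_area] is
   the n-dimensional surface measure. *)
Definition n_area_space (R : realType) (n : nat) :=
  caratheodory_type (hausdorff_dE R n).

Definition n_area (R : realType) (n : nat) :
    {measure set (n_area_space R n) -> \bar R} :=
  hausdorff_dE R n : set (caratheodory_type (hausdorff_dE R n)) -> \bar R.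

Definition sphere_partition (R : realType) (n : nat)
    (A A' : set (n_area_space R n)) : Prop :=
  [/\ measurable A, measurable A', A `|` A' = @sphere R n & A `&` A' = set0].

Definition heaviside (R : realType) (x : R) : R := if 0 < x then 1 else 0.

Section distance_functions.
Context (R : realType) (n : nat) (A : set (n_area_space R n)).

Definition cumulative_distance (l : R) : \bar R :=
  (\int[n_area R n]_(x in A) \int[n_area R n]_(y in A)
     (heaviside (l - dE x y))%:E)%E.

(* For A a subset of the sphere, [cumulative_distance] is finite and
   nondecreasing in l, so this derivative exists for almost every l, and it is
   meant up to null sets. *)
Definition distance_density (l : R) : R :=
  derive1 (fun t => fine (cumulative_distance t)) l.

End distance_functions.

(* Main.v *)
Require Import Defs.
From mathcomp Require Import all_boot all_order all_algebra.
From mathcomp Require Import all_classical all_reals all_analysis.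
From mathcomp Require Import measurable_realfun.
From mathcomp Require Import ring lra zify.
Import Order.TTheory GRing.Theory Num.Theory.
Import numFieldNormedType.Exports.

Local Open Scope classical_set_scope.
Local Open Scope ring_scope.

(** Write [St_A l] for the cumulative distance function of a part [A] of the
sphere and [g l] for the area of a spherical cap of chordal radius [l]; by the
homogeneity of the sphere, [g l] does not depend on the centre of the cap.
Splitting the cap around each [x] in [A] between [A] and its complement [A']
gives [St_A l + X = mu A * g l], where [X] is the measure of the pairs [(x, y)]
of [A `*` A'] at distance less than [l]. Exchanging the roles of [A] and [A']
replaces [X] by the measure of the reversed pairs, which is the same number by
Tonelli's theorem and the symmetry of the distance. Hence
[St_A l - St_A' l = (mu A - mu A') * g l] ([fine_cumulative_distance_diff],
from the general [integral_measure_xsection_diff]): for every [l] the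
difference depends only on [mu A - mu A'], and so does its derivative wherever
the functions involved are differentiable.

Three facts support this computation.
- The integrals make sense and Tonelli's theorem applies: the Hausdorff outer
  measure is additive on separated sets, so that, by Caratheodory's criterion,
  the coordinates and therefore the distance are measurable
  ([caratheodory_lipschitz]), and the sphere has finite area
  ([hausdorff_sphere_fin]).
- Any two points of the sphere are exchanged by a reflection, an isometry which
  preserves the sphere and the Hausdorff measure ([sphere_cap]).
- The functions [St_A] are nondecreasing, and a nondecreasing function is
  differentiable almost everywhere ([nondecreasing_ae_derivable], Lebesgue's
  theorem), so that outside a null set the derivative of a difference is the
  difference of the derivatives. *)

(** * Hausdorff measures as metric outer measures *)

Section metric_outer_measure.
Set Implicit Arguments.
Unset Strict Implicit.
Context {R : realType} {T : Type} (d : T -> T -> R) (n : nat).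
Local Notation H := (hausdorff d n).
Local Notation content := (hausdorff_content d n).
Local Notation weight := (hausdorff_weight d n).
Local Open Scope ereal_scope.

Lemma diam_le U e : diam d U <= e%:E <-> forall x y, U x -> U y -> (d x y <= e)%R.
Proof.
split=> [dU x y Ux Uy|dU].
  rewrite -lee_fin; apply: le_trans dU; apply: ereal_sup_ubound.
  by exists x => //; exists y.
by apply: ge_ereal_sup => _ [x Ux [y Uy <-]]; rewrite lee_fin dU.
Qed.

Lemma diamS U V e : U `<=` V -> diam d V <= e%:E -> diam d U <= e%:E.
Proof.
by move=> UV /diam_le dV; apply/diam_le => x y /UV + /UV; exact: dV.
Qed.

Lemma hausdorff_content_anti (A : set T) (e e' : R) :
  (e <= e')%R -> content e' A <= content e A.
Proof.
move=> ee'; apply: ereal_inf_le_tmp => _ [F [dF AF] <-].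
by exists F => //; split=> // k; rewrite (le_trans (dF k))// lee_fin.
Qed.

(** A set of diameter at most [e' < e] cannot meet both [A] and [B], so that a
cover of the union splits into a cover of [A] and a cover of [B]. *)
Lemma hausdorff_content_separated (A B : set T) (e e' : R) :
    (e' < e)%R -> (forall x y, A x -> B y -> (e <= d x y)%R) ->
  content e' A + content e' B <= content e' (A `|` B).
Proof.
move=> e'e AB; apply: le_ereal_inf_tmp => _ [F [dF ABF] <-].
pose G (C : set T) k := if `[< F k `&` C !=set0 >] then F k else set0.
have cG C : C `<=` A `|` B -> content e' C <= \sum_(k <oo) weight (G C k).
  move=> CAB; apply: ereal_inf_lbound; exists (G C) => //; split=> [k|x Cx].
    by rewrite /G; case: asboolP => [?|?]; [exact: dF|apply: diamS (dF k); exact: sub0set].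
  have [k _ Fx] := ABF _ (CAB _ Cx); exists k => //.
  by rewrite /G; case: asboolP => [?|[]] //; exists x.
apply: (le_trans (leeD (cG A (@subsetUl _ _ _)) (cG B (@subsetUr _ _ _)))).
have w0 C k : 0 <= weight (G C k) by exact: hausdorff_weight_ge0.
rewrite -nneseriesD//; apply: lee_nneseries => [k _ _|k _]; first exact: adde_ge0.
rewrite /G; case: asboolP => [[x [Fx Ax]]|_]; case: asboolP => [[y [Fy By]]|_].
- move/diam_le : (dF k) => /(_ x y Fx Fy).
  by move=> dxy; exfalso; have := AB x y Ax By; move: e'e; lra.
- by rewrite {2}/hausdorff_weight eqxx adde0.
- by rewrite {1}/hausdorff_weight eqxx add0e.
- by rewrite {1 2}/hausdorff_weight eqxx adde0 hausdorff_weight_ge0.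
Qed.

(** The contents of the two sets are taken at independent scales [e1] and [e2];
a common smaller scale, also below the gap [e], reduces to the previous
lemma. *)
Lemma hausdorff_separated (A B : set T) (e : R) :
    (0 < e)%R -> (forall x y, A x -> B y -> (e <= d x y)%R) ->
  H A + H B <= H (A `|` B).
Proof.
move=> e0 AB; have [->|ABoo] := eqVneq (H (A `|` B)) +oo; first by rewrite leey.
have fin C : C `<=` A `|` B -> H C \is a fin_num.
  move=> CAB; rewrite ge0_fin_numE ?hausdorff_ge0//.
  by rewrite (le_lt_trans (le_hausdorff d n CAB))// ltey.
have fA := fin A (@subsetUl _ _ _); have fB := fin B (@subsetUr _ _ _).
have key e1 e2 : (0 < e1)%R -> (0 < e2)%R -> content e1 A + content e2 B <= H (A `|` B).
  move=> e10 e20; pose t := Num.min (e / 2)%R (Num.min e1 e2).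
  have t0 : (0 < t)%R by rewrite !lt_min e10 e20 divr_gt0.
  have te : (t < e)%R by rewrite gt_min; apply/orP; left; lra.
  apply: (@le_trans _ _ (content t A + content t B)).
    by apply: leeD; apply: hausdorff_content_anti; rewrite /t !ge_min lexx !orbT.
  apply: (le_trans (hausdorff_content_separated te AB)).
  by apply: ereal_sup_ubound; exists t.
rewrite -leeBrDr//; apply: ge_ereal_sup => _ [e1 e10 <-].
have fc C t : (0 < t)%R -> H C \is a fin_num -> content t C \is a fin_num.
  move=> t0; rewrite ge0_fin_numE ?hausdorff_ge0// => HC.
  rewrite ge0_fin_numE ?hausdorff_content_ge0//; apply: le_lt_trans HC.
  by apply: ereal_sup_ubound; exists t.
rewrite leeBrDr// addeC -leeBrDr ?fc//.
apply: ge_ereal_sup => _ [e2 e20 <-].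
by rewrite leeBrDr ?fc// addeC; exact: key.
Qed.

(** Caratheodory's criterion. Approximating [f < r] from inside by the sets
[f <= t k], with [t k] increasing to [r], leaves a gap between [f <= t k] and
[r <= f], where additivity holds. What is lost is covered by the rings
[t j < f <= t j.+1], and the sum of their measures converges because rings
that are not adjacent are separated. *)
Lemma caratheodory_lipschitz (f : T -> R) (r : R) :
    (forall x y, (`|f x - f y| <= d x y)%R) ->
  (H : set T -> \bar R).-caratheodory [set x | (f x < r)%R].
Proof.
move=> fd; apply: (@le_caratheodory_measurable _ _ H) => X.
(* exposes [H] under the coercion from outer measures *)
change (H (X `&` [set x | (f x < r)%R]) + H (X `&` ~` [set x | (f x < r)%R]) <= H X).
have [->|Xoo] := eqVneq (H X) +oo; first by rewrite leey.
have fin C : H (X `&` C) \is a fin_num.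
  rewrite ge0_fin_numE ?hausdorff_ge0//.
  by rewrite (le_lt_trans (le_hausdorff d n (@subIsetl _ X C)))// ltey.
pose t k : R := (r - k.+1%:R^-1)%R.
have tS k : (t k < t k.+1)%R.
  by rewrite /t ltrD2l ltrN2 ltf_pV2 ?posrE// ltr_nat.
have tr k : (t k < r)%R by rewrite /t ltrBlDr ltrDl invr_gt0.
pose S k := X `&` [set x | (f x <= t k)%R].
pose D k := X `&` [set x | (t k < f x <= t k.+1)%R].
have sep k (C : set T) (s : R) : (t k < s)%R -> C `<=` [set x | (s <= f x)%R] ->
    H (S k) + H (X `&` C) <= H (X `&` ([set x | (f x <= t k)%R] `|` C)).
  move=> ts Cs; rewrite setIUr.
  apply: (@hausdorff_separated _ _ (s - t k)%R); first by rewrite subr_gt0.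
  move=> x y [_ /= fx] [_ /Cs/= fy]; apply: le_trans (fd x y).
  by rewrite distrC; apply: le_trans (ler_norm _); lra.
(* [D m.+1] lies at positive distance from [S m], and both are in
   [S m.+2]: induction on two consecutive indices replaces the usual split
   into even and odd rings. *)
have sumD m : \sum_(j < m) H (D j.+1) <= H (S m) + H (S m.+1).
  elim: m => [|m IH]; first by rewrite big_ord0 adde_ge0 ?hausdorff_ge0.
  rewrite big_ord_recr/=.
  apply: (le_trans (leeD2r _ IH)).
  rewrite -addeA addeCA leeD2l//.
  apply: (le_trans (@sep m _ (t m.+1) (tS m) _)); first by move=> x /= /andP[/ltW].
  apply: le_hausdorff => x [Xx /= fx]; split=> //=.
  have := tS m; have := tS m.+1.
  by case: fx => [|/andP[]]; lra.
have HX C : H (X `&` C) <= H X by apply: le_hausdorff; exact: subIsetl.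
have sumDoo : \sum_(j <oo) H (D j.+1) < +oo.
  apply: (@le_lt_trans _ _ (H X + H X)); last by rewrite lte_add_pinfty ?ltey.
  apply: lime_le; first by apply: is_cvg_nneseries => *; exact: hausdorff_ge0.
  near=> m; rewrite big_mkord; apply: (le_trans (sumD m)).
  by apply: leeD; exact: HX.
have tail := nneseries_tail_cvg sumDoo (fun k _ => hausdorff_ge0 d n _).
have cover k : H (X `&` [set x | (f x < r)%R]) <=
    H (S k.+1) + \sum_(k <= j <oo) H (D j.+1).
  apply: (@le_trans _ _ (H (S k.+1 `|` \bigcup_(j in ~` `I_k) D j.+1))).
    apply: le_hausdorff => x [Xx /= fr].
    have tx : exists m, (f x <= t m)%R.
      exists (Num.truncn (r - f x)^-1).
      have rf : (0 < r - f x)%R by rewrite subr_gt0.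
      rewrite /t lerBrDr -lerBrDl -[leRHS]invrK lef_pV2 ?posrE ?invr_gt0 ?ltr0n//.
      exact/ltW/truncnS_gt.
    case: (ex_minnP tx) => m fm mmin.
    have [mk|km] := leqP m k.+1.
      left; split=> //=; apply: (le_trans fm).
      by rewrite /t lerD2l lerN2 lef_pV2 ?posrE// ler_nat.
    case: m km fm mmin => [//|[//|m]] km fm mmin.
    right; exists m; first by rewrite /= leqNgt; apply/negP; rewrite negbK -ltnS.
    split=> //=; rewrite fm andbT ltNge; apply/negP => /mmin.
    by rewrite ltnn.
  apply: (le_trans (outer_measureU2 H _ _)); apply: leeD2l.
  exact: (outer_measure_sigma_subadditive_tail H k (fun j => D j.+1)).
apply/lee_addgt0Pr => e e0.
have /tail : nbhs (0 : \bar R) [set x | x < e%:E].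
  by apply: open_ereal_lt'; rewrite lte_fin.
case=> k _ /(_ k (leqnn k))/= ke.
apply: (@le_trans _ _ (H (S k.+1) + e%:E + H (X `&` ~` [set x | (f x < r)%R]))).
  by apply: leeD2r; apply: (le_trans (cover k)); apply: leeD2l; exact: ltW.
rewrite addeAC; apply: leeD2r.
apply: (le_trans (@sep k.+1 _ r (tr k.+1) _)); last exact: HX.
by move=> x /= /negP; rewrite -leNgt.
Unshelve. all: by end_near.
Qed.

End metric_outer_measure.

(** * Covers and isometries *)

Section hausdorff_covers.
Set Implicit Arguments.
Unset Strict Implicit.
Context {R : realType} {T : Type} (d : T -> T -> R) (n : nat).
Local Notation H := (hausdorff d n).
Local Notation content := (hausdorff_content d n).
Local Notation weight := (hausdorff_weight d n).
Local Open Scope ereal_scope.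

(** For an involution, preimages by [g] are also images by [g], so the
inequality [H (g @^-1` B) <= H B], obtained by pulling covers back, gives the
reverse one when applied twice. *)
Lemma hausdorff_involutive_isometry (g : T -> T) (A : set T) :
    involutive g -> (forall x y, d (g x) (g y) = d x y) ->
  H (g @^-1` A) = H A.
Proof.
move=> gK gd.
have diamE U : diam d (g @^-1` U) = diam d U.
  rewrite /diam; congr ereal_sup; apply/seteqP; split=> _ /= [x Ux [y Uy <-]].
    by exists (g x) => //; exists (g y) => //; rewrite gd.
  by exists (g x); rewrite /= ?gK//; exists (g y); rewrite /= ?gK// gd.
have le B : H (g @^-1` B) <= H B.
  apply: ge_ereal_sup => _ [e e0 <-].
  apply: (@le_trans _ _ (content e B)); last by apply: ereal_sup_ubound; exists e.
  apply: le_ereal_inf_tmp => _ [F [dF BF] <-].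
  apply: (@le_trans _ _ (\sum_(k <oo) weight (g @^-1` F k))).
    apply: ereal_inf_lbound; exists (fun k => g @^-1` F k) => //; split=> [k|x Bx].
      by rewrite diamE.
    by have [k _ Fx] := BF _ Bx; exists k.
  apply: lee_nneseries => [k _ _|k _]; first exact: hausdorff_weight_ge0.
  rewrite /hausdorff_weight diamE; case: (eqVneq (F k) set0) => [->|_].
    by rewrite preimage_set0 eqxx.
  by case: ifP => // _; rewrite lee_fin mulr_ge0 ?ball_volume_ge0 ?exprn_ge0 ?divr_ge0.
apply/eqP; rewrite eq_le le/=.
rewrite [leLHS](_ : _ = H (g @^-1` (g @^-1` A))) ?le//.
by rewrite -comp_preimage; congr H; apply/seteqP; split=> x /=; rewrite gK.
Qed.

Lemma hausdorff_weight_le (U : set T) (e : R) :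
    (forall x y, (0 <= d x y)%R) -> (0 <= e)%R -> diam d U <= e%:E ->
  weight U <= (ball_volume R n * (e / 2) ^+ n)%:E.
Proof.
move=> d0 e0 dU; rewrite /hausdorff_weight; case: ifPn => [_|/set0P[x Ux]].
  by rewrite lee_fin mulr_ge0 ?ball_volume_ge0 ?exprn_ge0 ?divr_ge0.
have dU0 : 0 <= diam d U.
  apply: (@le_trans _ _ (d x x)%:E); first by rewrite lee_fin.
  by apply: ereal_sup_ubound; exists x => //; exists x.
have fU : diam d U \is a fin_num by rewrite ge0_fin_numE// (le_lt_trans dU) ?ltry.
rewrite lee_fin ler_wpM2l ?ball_volume_ge0// lerXn2r ?nnegrE ?divr_ge0//.
rewrite ler_wpM2r ?invr_ge0// ger0_norm ?fine_ge0//.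
by rewrite -lee_fin fineK.
Qed.

(** Counting bound: [#|I|] pieces of diameter at most [e], completed by empty
sets into a sequence. *)
Lemma hausdorff_content_finite_cover (I : finType) (P : I -> set T) (e : R) (A : set T) :
    (forall x y, (0 <= d x y)%R) -> (0 <= e)%R ->
    A `<=` \bigcup_i P i -> (forall i, diam d (P i) <= e%:E) ->
  content e A <= (#|I|%:R * (ball_volume R n * (e / 2) ^+ n))%:E.
Proof.
move=> d0 e0 AP dP.
pose F k := if (insub k : option 'I_#|I|) is Some j then P (enum_val j) else set0.
have dF k : diam d (F k) <= e%:E.
  by rewrite /F; case: insubP => [j _ _|_]; [exact: dP|apply/diam_le].
apply: (@le_trans _ _ (\sum_(k <oo) weight (F k))).
  apply: ereal_inf_lbound; exists F => //; split=> // x /AP[i _ Px].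
  by exists (enum_rank i) => //; rewrite /F valK enum_rankK.
rewrite (@nneseries_split _ _ 0 #|I|)//=; last first.
  by move=> k _; exact: hausdorff_weight_ge0.
rewrite add0n [X in _ + X]eseries0 ?adde0; last first.
  by move=> k kI _; rewrite /F insubF ?ltnNge ?kI//= /hausdorff_weight eqxx.
rewrite big_mkord.
apply: (@le_trans _ _ (\sum_(k < #|I|) (ball_volume R n * (e / 2) ^+ n)%:E)).
  by apply: lee_sum => k _; exact: hausdorff_weight_le.
by rewrite sumEFin sumr_const card_ord mulr_natl.
Qed.

End hausdorff_covers.

(** * Homogeneity and finite area of the Euclidean sphere *)

Section euclidean.
Set Implicit Arguments.
Unset Strict Implicit.
Context {R : realType}.
Implicit Types m : nat.

Definition dot m (x y : 'rV[R]_m) : R := \sum_(i < m) x ord0 i * y ord0 i.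

Lemma dEE m (x y : 'rV[R]_m) : dE x y = Num.sqrt (dot (x - y) (x - y)).
Proof. by rewrite /dE /dot; congr Num.sqrt; apply: eq_bigr => i _; rewrite !mxE -expr2. Qed.

Lemma dotC m (x y : 'rV[R]_m) : dot x y = dot y x.
Proof. by apply: eq_bigr => i _; rewrite mulrC. Qed.

Lemma dotBl m (x y z : 'rV[R]_m) : dot (x - y) z = dot x z - dot y z.
Proof. by rewrite /dot -sumrB; apply: eq_bigr => i _; rewrite !mxE mulrBl. Qed.

Lemma dotZl m a (x z : 'rV[R]_m) : dot (a *: x) z = a * dot x z.
Proof. by rewrite /dot mulr_sumr; apply: eq_bigr => i _; rewrite !mxE mulrA. Qed.

Lemma dotBr m (x y z : 'rV[R]_m) : dot x (y - z) = dot x y - dot x z.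
Proof. by rewrite dotC dotBl !(dotC _ x). Qed.

Lemma dotZr m a (x z : 'rV[R]_m) : dot x (a *: z) = a * dot x z.
Proof. by rewrite dotC dotZl dotC. Qed.

Lemma dot_eq0 m (x : 'rV[R]_m) : dot x x = 0 -> x = 0.
Proof.
move=> x0; apply/rowP => i; rewrite mxE.
have /eqP := x0; rewrite psumr_eq0 => [|j _]; last by rewrite -expr2 sqr_ge0.
by move=> /allP/(_ i); rewrite mem_index_enum -expr2 sqrf_eq0 => /(_ isT)/eqP.
Qed.

Lemma dE_ge0 m (x y : 'rV[R]_m) : 0 <= dE x y.
Proof. exact: sqrtr_ge0. Qed.

Lemma dE_sym m (x y : 'rV[R]_m) : dE x y = dE y x.
Proof. by rewrite /dE; congr Num.sqrt; apply: eq_bigr => i _; rewrite -sqrrN opprB. Qed.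

Lemma dE_coord m (x y : 'rV[R]_m) i : `|x ord0 i - y ord0 i| <= dE x y.
Proof.
rewrite -sqrtr_sqr ler_sqrt; last by apply: sumr_ge0 => j _; exact: sqr_ge0.
by rewrite (bigD1 i)//= lerDl; apply: sumr_ge0 => j _; exact: sqr_ge0.
Qed.

Lemma dE_lt m (x y : 'rV[R]_m) l :
  (dE x y < l) = (0 < l) && (\sum_(i < m) (x ord0 i - y ord0 i) ^+ 2 < l ^+ 2).
Proof.
have s0 : 0 <= \sum_(i < m) (x ord0 i - y ord0 i) ^+ 2.
  by apply: sumr_ge0 => j _; exact: sqr_ge0.
have [l0|l0] := ltP 0 l; last by apply/negbTE; rewrite -leNgt (le_trans l0) ?dE_ge0.
by rewrite /dE -[X in _ < X](ger0_norm (ltW l0)) -sqrtr_sqr ltr_sqrt ?exprn_gt0.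
Qed.

Lemma dE_le m (x y : 'rV[R]_m) M :
  0 <= M -> (forall i, `|x ord0 i - y ord0 i| <= M) -> dE x y <= m%:R * M.
Proof.
move=> M0 xyM; case: m x y xyM => [|m] x y xyM.
  by rewrite /dE big_ord0 sqrtr0 mul0r.
have mM : 0 <= m.+1%:R * M by rewrite mulr_ge0.
rewrite -[leRHS](ger0_norm mM) -sqrtr_sqr ler_sqrt ?sqr_ge0//.
apply: (@le_trans _ _ (\sum_(i < m.+1) M ^+ 2)).
  by apply: ler_sum => i _; rewrite -real_normK ?num_real// lerXn2r ?nnegrE.
rewrite sumr_const card_ord -[leLHS]mulr_natl exprMn ler_wpM2r ?sqr_ge0//.
by rewrite -natrX ler_nat expnS leq_pmulr// expn_gt0.
Qed.

Lemma sphereE n (x : 'rV[R]_n.+1) : sphere x <-> \sum_i x ord0 i ^+ 2 = 1.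
Proof.
have -> : sphere x <-> Num.sqrt (\sum_i x ord0 i ^+ 2) = 1.
  rewrite /sphere/= /dE (eq_bigr (fun i => x ord0 i ^+ 2))// => i _.
  by rewrite mxE subr0.
have s0 : 0 <= \sum_i x ord0 i ^+ 2 by apply: sumr_ge0 => j _; exact: sqr_ge0.
split=> [s1|->]; last by rewrite sqrtr1.
by rewrite -(sqr_sqrtr s0) s1 expr1n.
Qed.

Lemma sphere_dot n (x : 'rV[R]_n.+1) : sphere x -> dot x x = 1.
Proof. by move=> /sphereE <-; apply: eq_bigr => i _; rewrite expr2. Qed.

(** The orthogonal reflection in the hyperplane [v^perp]. *)
Definition reflection m (v z : 'rV[R]_m) := z - (2 / dot v v * dot z v) *: v.

Lemma reflectionB m (v a b : 'rV[R]_m) :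
  reflection v a - reflection v b = reflection v (a - b).
Proof.
by rewrite /reflection dotBl mulrBr scalerBl opprD addrACA -opprD.
Qed.

Lemma dE_reflection m (v a b : 'rV[R]_m) :
  v != 0 -> dE (reflection v a) (reflection v b) = dE a b.
Proof.
move=> v0; have dv : dot v v != 0 by apply: contra_neq v0 => /dot_eq0.
rewrite !dEE reflectionB; move: (a - b) => w; congr Num.sqrt.
by rewrite /reflection !dotBl !dotBr !dotZl !dotZr (dotC v w); field.
Qed.

Lemma reflectionK m (v : 'rV[R]_m) : v != 0 -> involutive (reflection v).
Proof.
move=> v0 z; have dv : dot v v != 0 by apply: contra_neq v0 => /dot_eq0.
rewrite /reflection dotBl dotZl -addrA -opprD -scalerDl.
by rewrite [X in X *: v](_ : _ = 0) ?scale0r ?subr0//; field.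
Qed.

(** Two unit vectors [x] and [y] are exchanged by the reflection in their
mediating hyperplane, because [dot (x - y) (x - y) = 2 * dot x (x - y)]. *)
Lemma reflection_swap n (x y : 'rV[R]_n.+1) : sphere x -> sphere y -> x != y ->
  reflection (x - y) x = y.
Proof.
move=> sx sy xy.
have dv : dot (x - y) (x - y) != 0.
  by apply: contra_neq xy => /dot_eq0/eqP; rewrite subr_eq0 => /eqP.
have E : dot (x - y) (x - y) = 2 * dot x (x - y).
  by rewrite !dotBl !dotBr (dotC y x) !sphere_dot//; ring.
have E' : 2 / dot (x - y) (x - y) * dot x (x - y) = 1.
  by rewrite mulrAC -E divff.
by rewrite /reflection E' scale1r opprB addrC subrK.
Qed.

(** Homogeneity of the sphere: the reflection exchanging [x] and [y] maps one
cap to the other. *)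
Lemma sphere_cap n (x y : 'rV[R]_n.+1) l : sphere x -> sphere y ->
  hausdorff_dE R n (@sphere R n `&` [set z | dE x z < l]) =
  hausdorff_dE R n (@sphere R n `&` [set z | dE y z < l]).
Proof.
move=> sx sy; have [->//|xy] := eqVneq x y.
have v0 : x - y != 0 by rewrite subr_eq0.
rewrite -[LHS](hausdorff_involutive_isometry n _ (reflectionK v0)); last first.
  by move=> a b; exact: dE_reflection.
congr (hausdorff_dE R n _); rewrite preimage_setI; congr (_ `&` _).
  have r0 : reflection (x - y) 0 = 0.
    by rewrite /reflection -(scale0r 0) dotZl mul0r mulr0 !scale0r subr0.
  have dz z : dE (reflection (x - y) z) 0 = dE z 0.
    by rewrite -[RHS](dE_reflection _ _ v0) r0.
  by apply/seteqP; split=> z; rewrite /sphere/= dz.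
have yE : reflection (x - y) y = x.
  by rewrite -[RHS](reflectionK v0) (reflection_swap sx sy xy).
have dz z : dE x (reflection (x - y) z) = dE y z.
  by rewrite -[RHS](dE_reflection _ _ v0) yE.
by apply/seteqP; split=> z /=; rewrite dz.
Qed.

(** The points of the sphere whose coordinate [i] has the sign given by [s]
and is at least [1 / (n + 1)] in absolute value, and whose [n] other
coordinates lie in a given cube of side [1 / N]. The number of cells is of
order [N ^ n], since coordinate [i] is determined by the other ones. *)
Definition sphere_cell n N (i : 'I_n.+1) (s : bool)
    (k : {ffun 'I_n -> 'I_(2 * N).+1}) : set 'rV[R]_n.+1 :=
  [set x | [/\ sphere x, n.+1%:R^-1 <= (-1) ^+ s * x ord0 i &
    forall j, (k j)%:R <= N%:R * (x ord0 (lift i j) + 1) <= (k j).+1%:R]].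

Lemma sphere_coord_le1 n (x : 'rV[R]_n.+1) i : sphere x -> `|x ord0 i| <= 1.
Proof.
by move=> x1; have := dE_coord x 0 i; rewrite mxE subr0 (_ : dE x 0 = 1).
Qed.

(** Coordinate [i] is a Lipschitz function of the other ones on a cell: from
[X ^+ 2 - Y ^+ 2 = \sum_j (y_j ^+ 2 - x_j ^+ 2)], the bound [2 * n / N] on the
right-hand side and [2 / (n + 1) <= `|X + Y|]. *)
Lemma dE_sphere_cell n N (i : 'I_n.+1) s (k : {ffun 'I_n -> 'I_(2 * N).+1})
    (x y : 'rV[R]_n.+1) : (0 < N)%N -> sphere_cell i s k x -> sphere_cell i s k y ->
  dE x y <= n.+1%:R * (n.+1%:R ^+ 2 / N%:R).
Proof.
move=> N0 [sx xi xk] [sy yi yk].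
have N0' : 0 < N%:R :> R by rewrite ltr0n.
have xyj j : `|x ord0 (lift i j) - y ord0 (lift i j)| <= N%:R^-1.
  have /andP[] := xk j; have /andP[] := yk j; rewrite -(natr1 (k j)).
  move=> h1 h2 h3 h4.
  rewrite -[leRHS]mul1r ler_pdivlMr// mulrC -{1}(gtr0_norm N0') -normrM ler_norml.
  by apply/andP; split; lra.
have xyi : `|x ord0 i - y ord0 i| <= n.+1%:R ^+ 2 / N%:R.
  set X := x ord0 i in xi *; set Y := y ord0 i in yi *.
  have sq : X ^+ 2 - Y ^+ 2 = \sum_(j < n) (y ord0 (lift i j) ^+ 2 - x ord0 (lift i j) ^+ 2).
    have /sphereE := sx; have /sphereE := sy.
    rewrite !(bigD1_ord i)//= -/X -/Y sumrB => h1 h2; lra.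
  have le1 : `|X - Y| * `|X + Y| <= 2 * n%:R / N%:R.
    rewrite -normrM -subr_sqr sq.
    apply: (le_trans (ler_norm_sum _ _ _)).
    apply: (@le_trans _ _ (\sum_(j < n) 2 / N%:R)).
      apply: ler_sum => j _; rewrite subr_sqr normrM mulrC ler_pM//.
        apply: (le_trans (ler_normD _ _)).
        have := sphere_coord_le1 (lift i j) sx; have := sphere_coord_le1 (lift i j) sy; lra.
      by rewrite distrC.
    by rewrite sumr_const card_ord -[leLHS]mulr_natl mulrCA mulrA.
  have ge : 2 / n.+1%:R <= `|X + Y|.
    have : 2 / n.+1%:R <= (-1) ^+ s * (X + Y).
      by rewrite mulrDr -[2]/(1 + 1) mulrDl mul1r lerD.
    move=> /le_trans; apply; apply: (le_trans (ler_norm _)).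
    by rewrite normrM normr_sign mul1r.
  have := le_trans (ler_wpM2l (normr_ge0 (X - Y)) ge) le1.
  have n0 : 0 < n.+1%:R :> R by rewrite ltr0n.
  rewrite mulrA ler_pdivrMr// => h.
  have : `|X - Y| * 2 <= (n.+1%:R ^+ 2 / N%:R) * 2.
    apply: (le_trans h); rewrite expr2.
    rewrite [leLHS](_ : _ = n%:R * n.+1%:R / N%:R * 2); last by ring.
    rewrite ler_pM2r// ler_pM2r ?invr_gt0// ler_pM2r// ler_nat//.
  by rewrite ler_pM2r.
apply: dE_le => [|j]; first by rewrite divr_ge0// exprn_ge0.
case: (unliftP i j) => [j' ->|-> //].
apply: (le_trans (xyj j')); rewrite -[leLHS]mul1r.
by rewrite ler_wpM2r ?invr_ge0 ?exprn_ege1 ?ler1n// ltW.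
Qed.

(** If all coordinates were below [1 / (n + 1)], the sum of their squares
would be below [1 / (n + 1)] instead of being [1]. *)
Lemma sphere_cell_cover n N (x : 'rV[R]_n.+1) : sphere x ->
  exists i s k, sphere_cell (N := N) i s k x.
Proof.
move=> sx.
have n0 : 0 < n.+1%:R :> R by rewrite ltr0n.
have [i xi] : exists i, n.+1%:R^-1 <= `|x ord0 i|.
  apply: contrapT => /forallNP h.
  have /sphereE := sx; apply/eqP; rewrite lt_eqF//.
  apply: (@lt_le_trans _ _ (\sum_(i < n.+1) n.+1%:R^-1 ^+ 2)).
    apply: ltr_sum; first by apply/hasP; exists ord0; rewrite ?mem_index_enum.
    move=> i _; rewrite -real_normK ?num_real// ltrXn2r ?nnegrE ?invr_ge0//.
    by rewrite ltNge; apply/negP/h.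
  rewrite sumr_const card_ord -[leLHS]mulr_natl expr2 mulVKf ?gt_eqF//.
  by rewrite invf_le1// ler1n.
pose k : {ffun 'I_n -> 'I_(2 * N).+1} :=
  [ffun j => inord (Num.truncn (N%:R * (x ord0 (lift i j) + 1)))].
exists i, (x ord0 i < 0), k; split=> //.
  by rewrite -real_normrEsign ?num_real.
move=> j; rewrite ffunE.
have := sphere_coord_le1 (lift i j) sx; rewrite ler_norml => /andP[x1 x2].
have t0 : 0 <= N%:R * (x ord0 (lift i j) + 1) by rewrite mulr_ge0//; lra.
have tN : (Num.truncn (N%:R * (x ord0 (lift i j) + 1)) <= 2 * N)%N.
  rewrite truncn_le_nat -natr1 natrM; apply: (@le_lt_trans _ _ (2 * N%:R)); last lra.
  by rewrite mulrC ler_wpM2r//; lra.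
rewrite inordK ?ltnS//.
by have /andP[-> /ltW ->] := truncn_itv t0.
Qed.

(** At scale [K / N] the sphere is covered by [2 * (n + 1) * (2 * N + 1) ^ n]
cells of weight proportional to [(K / N) ^ n]; as [2 * N + 1 <= 3 * N], the
total weight is bounded independently of [N]. *)
Lemma hausdorff_sphere_fin n : (hausdorff_dE R n (@sphere R n) < +oo)%E.
Proof.
pose K : R := n.+1%:R * n.+1%:R ^+ 2.
pose c : R := n.+1%:R * 2 * (ball_volume R n * (3 * K / 2) ^+ n).
suff : (hausdorff_dE R n (@sphere R n) <= c%:E)%E by move=> /le_lt_trans; apply; rewrite ltry.
apply: ge_ereal_sup => _ [e e0 <-].
have K0 : 0 < K by rewrite mulr_gt0// exprn_gt0.
pose N := (Num.truncn (K / e)).+1.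
have N0 : 0 < N%:R :> R by rewrite ltr0n.
have KN : K / N%:R <= e.
  rewrite ler_pdivrMr// -ler_pdivrMl// mulrC; exact/ltW/truncnS_gt.
apply: (le_trans (hausdorff_content_anti _ _ _ KN)).
pose P (t : 'I_n.+1 * bool * {ffun 'I_n -> 'I_(2 * N).+1}) := sphere_cell t.1.1 t.1.2 t.2.
apply: (le_trans (@hausdorff_content_finite_cover _ _ _ _ _ P (K / N%:R) _ _ _ _ _)).
- exact: dE_ge0.
- by rewrite divr_ge0// ltW.
- by move=> x /(sphere_cell_cover N)[i [s [k xk]]]; exists (i, s, k).
- move=> t; apply/diam_le => x y Px Py; rewrite /K -mulrA.
  exact: dE_sphere_cell Px Py.
rewrite lee_fin !card_prod card_ord card_bool card_ffun !card_ord !natrM /c.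
rewrite -mulrA ler_pM2l ?mulr_gt0// mulrCA ler_wpM2l ?ball_volume_ge0//.
rewrite natrX -exprMn lerXn2r ?nnegrE ?mulr_ge0 ?divr_ge0//; try exact: ltW.
have : (2 * N).+1%:R <= 3 * N%:R :> R by rewrite -natrM ler_nat /N; lia.
have -> : 3 * K / 2 = 3 * N%:R * (K / N%:R / 2) by field; rewrite gt_eqF.
by move=> h; rewrite ler_wpM2r// !divr_ge0// ltW.
Qed.

End euclidean.

(** * Homogeneous symmetric kernels and partitions *)

(** [K] is a symmetric measurable relation on a space with a measure [mu],
finite on [S]. In the application [S] is the sphere and [K] relates the points
at distance less than [l]. *)
Section homogeneous_kernel.
Set Implicit Arguments.
Unset Strict Implicit.
Local Open Scope ereal_scope.
Context {disp : measure_display} {E : measurableType disp} {R : realType}.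
Variables (mu : {measure set E -> \bar R}) (S : set E) (K : set (E * E)).
Hypotheses (mS : measurable S) (Sfin : mu S < +oo) (mK : measurable K).
Hypothesis Ksym : forall x y, K (x, y) -> K (y, x).
Implicit Types A B : set E.

(** Tonelli's theorem requires sigma-finite measures, and [mu] is only known
to be finite on [S]: it is replaced by its restriction to [S]. *)
Lemma finite_measure_on : exists nu : {finite_measure set E -> \bar R},
  forall A, A `<=` S -> nu A = mu A.
Proof.
by exists (mfrestr mS Sfin) => A AS; rewrite /= /mfrestr /mrestr setIidl.
Qed.

Let finS A : measurable A -> A `<=` S -> mu A \is a fin_num.
Proof.
move=> mA AS; rewrite ge0_fin_numE ?measure_ge0//; apply: le_lt_trans Sfin.
by apply: le_measure => //; rewrite inE.
Qed.

Let mKx A x : measurable A -> measurable (A `&` xsection K x).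
Proof. by move=> mA; apply: measurableI => //; exact: measurable_xsection. Qed.

Lemma measurable_measure_xsection A : measurable A -> A `<=` S ->
  measurable_fun setT (fun x => mu (A `&` xsection K x)).
Proof.
move=> mA AS; have [nu nuE] := finite_measure_on.
apply: (eq_measurable_fun (nu \o xsection ((setT `*` A) `&` K))) => [x _|].
  rewrite /comp -[RHS]nuE => [|y [/AS]//].
  congr (nu _); apply/seteqP; split=> y; rewrite /xsection/= !inE/=.
    by move=> [[_ Ay]].
  by move=> [].
by apply: measurable_fun_xsection; apply: measurableI => //; exact: measurableX.
Qed.

(** Both sides are the measure of the pairs of [A `*` B] related by [K], up to
the exchange of the two components. *)
Lemma measure_xsection_swap A B : measurable A -> measurable B ->
    A `<=` S -> B `<=` S ->
  \int[mu]_(x in A) mu (B `&` xsection K x) = \int[mu]_(x in B) mu (A `&` xsection K x).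
Proof.
move=> mA mB AS BS; have [nu nuE] := finite_measure_on.
have integral_nu C f : measurable C -> C `<=` S ->
    \int[mu]_(x in C) f x = \int[nu]_(x in C) f x.
  move=> mC CS; apply: eq_measure_integral => D mD DC; apply/esym/nuE.
  exact: subset_trans CS.
pose X := (A `*` B) `&` K.
have mX : measurable X by apply: measurableI => //; exact: measurableX.
have : \int[nu]_x nu (xsection X x) = \int[nu]_y nu (ysection X y).
  exact: (product_measure_unique (product_measure2E nu nu) mX).
rewrite (integral_nu A)// (integral_nu B)//.
rewrite (integral_mkcond A) (integral_mkcond B) => XE.
transitivity (\int[nu]_x nu (xsection X x)); last rewrite XE.
  apply: eq_integral => x _; rewrite patchE.
  case: ifPn; rewrite ?inE ?notin_setE => Ax.
    rewrite -[LHS]nuE => [|y [/BS]//].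
    congr (nu _); apply/seteqP; split=> y; rewrite /xsection/= !inE/=.
      by move=> [].
    by move=> [[]].
  rewrite (_ : xsection X x = set0) ?measure0//.
  by apply/seteqP; split=> y //; rewrite /xsection/= inE/= => -[[]].
apply: eq_integral => x _; rewrite patchE.
case: ifPn; rewrite ?inE ?notin_setE => Bx.
  rewrite -[RHS]nuE => [|y [/AS]//].
  congr (nu _); apply/seteqP; split=> y; rewrite /xsection/ysection/= !inE/=.
    by move=> [[? ?] /Ksym].
  by move=> [? /Ksym].
rewrite (_ : ysection X x = set0) ?measure0//.
by apply/seteqP; split=> y //; rewrite /ysection/= inE/= => -[[]].
Qed.

Lemma integral_measure_xsection_fin A B : measurable A -> measurable B ->
    A `<=` S -> B `<=` S ->
  \int[mu]_(x in A) mu (B `&` xsection K x) \is a fin_num.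
Proof.
move=> mA mB AS BS; rewrite ge0_fin_numE ?integral_ge0//.
apply: (@le_lt_trans _ _ (mu B * mu A)).
  rewrite -integral_cst//; apply: ge0_le_integral => //.
  - by apply: measurable_funTS; exact: measurable_measure_xsection.
  - by move=> x _; apply: le_measure; rewrite ?inE//; exact: mKx.
by rewrite -ge0_fin_numE ?mule_ge0// fin_numM ?finS.
Qed.

Lemma integral_measure_xsection_split A A' g :
    measurable A -> measurable A' -> A `|` A' = S -> A `&` A' = set0 ->
    (forall x, S x -> mu (S `&` xsection K x) = g) ->
  \int[mu]_(x in A) mu (A `&` xsection K x) +
  \int[mu]_(x in A) mu (A' `&` xsection K x) = mu A * g.
Proof.
move=> mA mA' AA'S AA'0 gE.
have AS : A `<=` S by rewrite -AA'S; exact: subsetUl.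
have A'S : A' `<=` S by rewrite -AA'S; exact: subsetUr.
rewrite -ge0_integralD//; [|by apply: measurable_funTS; exact: measurable_measure_xsection..].
rewrite muleC -[RHS]integral_cst//; apply: eq_integral => x; rewrite inE => /AS Sx.
rewrite -measureU.
- by rewrite -setIUl AA'S; exact: gE.
- exact: mKx.
- exact: mKx.
- by rewrite setIACA AA'0 set0I.
Qed.

(** The two splittings, of [A] and of [A'], have the same cross term. *)
Lemma integral_measure_xsection_diff A A' g :
    measurable A -> measurable A' -> A `|` A' = S -> A `&` A' = set0 ->
    g \is a fin_num -> (forall x, S x -> mu (S `&` xsection K x) = g) ->
  (fine (\int[mu]_(x in A) mu (A `&` xsection K x)) -
   fine (\int[mu]_(x in A') mu (A' `&` xsection K x)) =
   (fine (mu A) - fine (mu A')) * fine g)%R.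
Proof.
move=> mA mA' AA'S AA'0 gfin gE.
have AS : A `<=` S by rewrite -AA'S; exact: subsetUl.
have A'S : A' `<=` S by rewrite -AA'S; exact: subsetUr.
have := integral_measure_xsection_split mA mA' AA'S AA'0 gE.
have := integral_measure_xsection_split mA' mA _ _ gE.
rewrite setUC setIC => /(_ AA'S AA'0).
rewrite (measure_xsection_swap mA' mA A'S AS).
have fin B C : measurable B -> B `<=` S -> measurable C -> C `<=` S ->
    \int[mu]_(x in B) mu (C `&` xsection K x) \is a fin_num.
  by move=> mB BS mC CS; exact: integral_measure_xsection_fin.
have := fin A A mA AS mA AS; have := fin A' A' mA' A'S mA' A'S.
have := fin A A' mA AS mA' A'S.
move: (\int[mu]_(x in A) _) (\int[mu]_(x in A') _) (\int[mu]_(x in A) _).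
move=> a b c cfin bfin afin.
have := finS mA AS; have := finS mA' A'S.
move: (mu A) (mu A') => m m' m'fin mfin.
rewrite -(fineK cfin) -(fineK bfin) -(fineK afin) -(fineK m'fin) -(fineK mfin).
rewrite -(fineK gfin) -!EFinD -!EFinM => -[h1] -[h2] /=.
by rewrite mulrBl -h1 -h2; ring.
Qed.

End homogeneous_kernel.

Lemma le_integral_measure_xsection (disp : measure_display)
    (E : measurableType disp) (R : realType) (mu : {measure set E -> \bar R})
    (S : set E) (K K' : set (E * E)) (A : set E) :
    measurable S -> (mu S < +oo)%E -> measurable K -> measurable K' ->
    K `<=` K' -> measurable A -> A `<=` S ->
  (\int[mu]_(x in A) mu (A `&` xsection K x) <=
   \int[mu]_(x in A) mu (A `&` xsection K' x))%E.
Proof.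
move=> mS Sfin mK mK' KK' mA AS; apply: ge0_le_integral => //.
- by apply: measurable_funTS; exact: (measurable_measure_xsection mS Sfin).
- by apply: measurable_funTS; exact: (measurable_measure_xsection mS Sfin).
- move=> x _; apply: le_measure; rewrite ?inE.
  + by apply: measurableI => //; exact: measurable_xsection.
  + by apply: measurableI => //; exact: measurable_xsection.
  + by apply: setIS; exact: le_xsection.
Qed.

(** * Almost everywhere differentiability of monotone functions *)

Section monotone_derivable.
Set Implicit Arguments.
Unset Strict Implicit.
Context {R : realType}.
(** The Lebesgue outer measure. The sets of points of non-differentiability
are handled through it, without showing that they are measurable. *)
Let leb : {outer_measure set R -> \bar R} :=
  [the {outer_measure set (ocitv_type R) -> \bar R} of (wlength (@idfun R))^*%mu].

Lemma outer_measure_diff0 (mu : {outer_measure set R -> \bar R}) (A B : set R) :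
  mu (A `\` B) = 0%E -> (mu A <= mu (A `&` B))%E.
Proof.
by move=> AB0; rewrite (le_trans (le_outer_measureIC mu B A))// -setDE AB0 adde0.
Qed.

Lemma leb_bigcup_itv (a b : nat -> R) (D : set nat) :
    (forall k, D k -> a k < b k) -> trivIset D (fun k => `[a k, b k]%classic) ->
  leb (\bigcup_(k in D) `[a k, b k]%classic) =
    (\sum_(k <oo | k \in D) (b k - a k)%:E)%E.
Proof.
move=> ab tD.
have -> : leb (\bigcup_(k in D) `[a k, b k]%classic) =
    lebesgue_measure (\bigcup_(k in D) `[a k, b k]%classic) by [].
rewrite measure_bigcup//; apply: eq_eseriesr => k; rewrite inE => /ab abk.
by have := lebesgue_measure_itv `[a k, b k]; rewrite /= lte_fin abk.
Qed.

(** Vitali's covering theorem for the intervals satisfying [P]. The covering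
theorem used takes a sequence of balls, which is why the intervals that
straddle the points of [E] have rational endpoints. *)
Lemma vitali_rat_intervals (E : set R) (P : R -> R -> Prop) :
    (forall x, E x -> forall e, 0 < e -> exists p q : rat,
      [/\ (ratr p : R) < x < ratr q, (ratr q : R) - ratr p < e & P (ratr p) (ratr q)]) ->
  exists a b : nat -> R, exists D : set nat,
    [/\ forall k, D k -> a k < b k /\ P (a k) (b k),
        trivIset D (fun k => `[a k, b k]%classic) &
        leb (E `\` \bigcup_(k in D) `[a k, b k]%classic) = 0%E].
Proof.
move=> EP.
(* an enumeration of the nonempty rational intervals, [0, 1] being the
   default value *)
pose I k : rat * rat :=
  if unpickle k is Some pq then if pq.1 < pq.2 :> rat then pq else (0, 1)
  else (0, 1).
have I12 k : (I k).1 < (I k).2.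
  by rewrite /I; case: unpickle => // pq; case: ifP.
pose a k : R := ratr (I k).1; pose b k : R := ratr (I k).2.
have ab k : a k < b k by rewrite ltr_rat.
pose c k := (a k + b k) / 2; pose r k := (b k - a k) / 2.
have r0 k : 0 < r k by rewrite /r; have := ab k; lra.
have cr k : c k - r k = a k /\ c k + r k = b k by rewrite /c /r; split; field.
pose B k := ball (c k) (r k).
have radB k : ((radius (B k))%:num = r k)%R by rewrite radius_ball_num// ltW.
have clB k : closure (B k) = `[a k, b k]%classic.
  by have [<- <-] := cr k; rewrite closure_ballE closed_ball_itv.
have [||D [_ DV tD E0]] := @vitali_theorem R E B _ [set k | P (a k) (b k)].
- by move=> k; rewrite radB.
- split=> [k|x Ex e e0]; first exact: is_ball_ball.
  have [p [q [/andP[px xq] pqe Ppq]]] := EP x Ex e e0.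
  have pq : p < q by rewrite -(ltr_rat R); exact: lt_trans xq.
  have Ik : I (pickle (p, q)) = (p, q) by rewrite /I pickleK/= pq.
  exists (pickle (p, q)); split; rewrite /= /a /b ?Ik//.
    by rewrite /B ball_itv/= in_itv/= (cr _).1 (cr _).2 /a /b Ik px xq.
  rewrite radB; apply: le_lt_trans pqe.
  have := ab (pickle (p, q)); rewrite /r /a /b Ik/=; lra.
exists a, b, D; split.
- by move=> k /DV.
- by move=> i j Di Dj; rewrite -!clB; exact: tD.
- by rewrite -[RHS]E0; under eq_bigcupr do rewrite -clB.
Qed.

(** As [f] is nondecreasing, disjoint intervals [`[a k, b k]] have disjoint
images [`[f (a k), f (b k)[], all contained in [`[f l, f r[]. *)
Lemma lebesgue_increments (f : R -> R) (a b : nat -> R) (D : set nat) (l r : R) :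
  {homo f : x y / x <= y} ->
  l <= r -> (forall k, D k -> l <= a k /\ a k <= b k /\ b k <= r) ->
  trivIset D (fun k => `[a k, b k]%classic) ->
  (\sum_(k <oo | k \in D) (f (b k) - f (a k))%:E <= (f r - f l)%:E)%E.
Proof.
move=> fh lr abD tD.
have -> : (f r - f l)%:E = lebesgue_measure `[f l, f r[%classic.
  rewrite lebesgue_measure_itv/= lte_fin; case: ltP => // h.
  by rewrite (le_anti (introT andP (conj h (fh _ _ lr)))) subrr.
rewrite (eq_eseriesr (g := fun k => lebesgue_measure `[f (a k), f (b k)[%classic)); last first.
  move=> k; rewrite inE => /abD [? [ab ?]].
  rewrite lebesgue_measure_itv/= lte_fin; case: ltP => // h.
  by rewrite (le_anti (introT andP (conj h (fh _ _ ab)))) subrr.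
rewrite -measure_bigcup//; last first.
  apply/trivIsetP => i j Di Dj ij.
  have [/abD[_ [abi _]] /abD[_ [abj _]]] := (Di, Dj).
  apply/seteqP; split=> // y [] /=; rewrite !in_itv/= => /andP[ai bi] /andP[aj bj].
  move/trivIsetP : tD => /(_ i j Di Dj ij)/seteqP[+ _].
  have [h|h] := leP (a i) (a j).
    have bij : a j <= b i.
      rewrite leNgt; apply/negP => /ltW/fh; lra.
    by move=> /(_ (a j)); apply; rewrite /= !in_itv/= h bij lexx abj.
  have bij : a i <= b j.
    rewrite leNgt; apply/negP => /ltW/fh; lra.
  by move=> /(_ (a i)); apply; rewrite /= !in_itv/= (ltW h) bij lexx abi.
apply: le_outer_measure => y [k Dk] /=; rewrite !in_itv/= => /andP[h1 h2].
have [/fh la [ab /fh br]] := abD k Dk.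
by rewrite (le_trans la h1) (lt_le_trans h2 br).
Qed.

(** Slopes are taken over intervals that strictly straddle [x], rather than
over intervals with [x] as an endpoint: the endpoints can then be moved a
little, in particular to rational numbers. *)
Definition finely_straddled (P : R -> R -> Prop) (x : R) :=
  forall e, 0 < e -> exists a b, [/\ a < x < b, b - a < e & P a b].

Definition steep (f : R -> R) (v a b : R) := v * (b - a) < f b - f a.
Definition shallow (f : R -> R) (u a b : R) := f b - f a < u * (b - a).

(** Enlarging a steep interval increases the increment of [f], hence keeps it
steep if the enlargement is small. *)
Lemma steep_rat f v x : {homo f : x y / x <= y} -> 0 < v ->
  finely_straddled (steep f v) x -> forall e, 0 < e -> exists p q : rat,
  [/\ (ratr p : R) < x < ratr q, (ratr q : R) - ratr p < e &
      steep f v (ratr p) (ratr q)].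
Proof.
move=> fh v0 fx e e0; have [a [b [/andP[ax xb] bae]]] := fx e e0.
rewrite /steep => Pab.
pose t := Num.min ((e - (b - a)) / 2) ((f b - f a - v * (b - a)) / (2 * v)).
have t0 : 0 < t by rewrite lt_min !divr_gt0 ?subr_gt0// mulr_gt0.
have te : t <= (e - (b - a)) / 2 by rewrite ge_min lexx.
have tv : t * (2 * v) <= f b - f a - v * (b - a).
  by rewrite -ler_pdivlMr ?mulr_gt0// ge_min lexx orbT.
have /rat_in_itvoo[p] : a - t < a by lra.
have /rat_in_itvoo[q] : b < b + t by lra.
rewrite !in_itv/= => /andP[bq qb] /andP[ap pa].
exists p, q; split; [by apply/andP; split; lra | by lra |].
have := fh _ _ (ltW pa); have := fh _ _ (ltW bq).
have : v * (ratr q - ratr p) < v * (b - a + 2 * t) by rewrite ltr_pM2l//; lra.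
lra.
Qed.

(** Dually, shrinking a shallow interval decreases the increment of [f]. *)
Lemma shallow_rat f u x : {homo f : x y / x <= y} -> 0 < u ->
  finely_straddled (shallow f u) x -> forall e, 0 < e -> exists p q : rat,
  [/\ (ratr p : R) < x < ratr q, (ratr q : R) - ratr p < e &
      shallow f u (ratr p) (ratr q)].
Proof.
move=> fh u0 fx e e0; have [a [b [/andP[ax xb] bae]]] := fx e e0.
rewrite /shallow => Pab.
pose t := (u * (b - a) - (f b - f a)) / (2 * u).
have t0 : 0 < t by rewrite !divr_gt0 ?subr_gt0// mulr_gt0.
have tu : t * (2 * u) = u * (b - a) - (f b - f a).
  by rewrite /t; field; rewrite gt_eqF.
have /rat_in_itvoo[p] : a < Num.min x (a + t) by rewrite lt_min ax/=; lra.
have /rat_in_itvoo[q] : Num.max x (b - t) < b by rewrite gt_max xb/=; lra.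
rewrite !in_itv/= lt_min gt_max => /andP[/andP[xq bq] qb] /andP[ap /andP[px pa]].
exists p, q; split; [by apply/andP; split; lra | by lra |].
have := fh _ _ (ltW ap); have := fh _ _ (ltW qb).
have : u * (b - a - 2 * t) < u * (ratr q - ratr p) by rewrite ltr_pM2l//; lra.
lra.
Qed.

(** Almost all of [E] is covered by disjoint steep intervals in [`[l, r]],
whose total length is at most the total increment of [f] divided by [v]. *)
Lemma lebesgue_steep f v l r (E : set R) :
    {homo f : x y / x <= y} -> 0 < v -> l <= r -> E `<=` `]l, r[ ->
    (forall x, E x -> finely_straddled (steep f v) x) ->
  (leb E <= ((f r - f l) / v)%:E)%E.
Proof.
move=> fh v0 lr Elr Ev.
have [x Ex e e0|a [b [D [abD tD E0]]]] := @vitali_rat_intervals E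
    (fun a b => [/\ l <= a, b <= r & steep f v a b]).
  have := Elr x Ex; rewrite /= in_itv/= => /andP[lx xr].
  have e'0 : 0 < Num.min e (Num.min (x - l) (r - x)).
    by rewrite !lt_min e0 !subr_gt0 lx xr.
  have [p [q [/andP[px xq] pqe Ppq]]] := steep_rat fh v0 (Ev x Ex) e'0.
  move: pqe; rewrite !lt_min => /and3P[pqe pl rq].
  by exists p, q; split; [exact/andP | | split=> //; lra].
apply: (@le_trans _ _ (leb (\bigcup_(k in D) `[a k, b k]%classic))).
  apply: (le_trans (outer_measure_diff0 E0)).
  by apply: le_outer_measure; exact: subIsetr.
have -> : leb (\bigcup_(k in D) `[a k, b k]%classic) =
    (\sum_(k <oo | k \in D) (b k - a k)%:E)%E.
  by apply: leb_bigcup_itv => // k /abD[].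
apply: (@le_trans _ _ (\sum_(k <oo | k \in D) (v^-1%:E * (f (b k) - f (a k))%:E))%E).
  apply: lee_nneseries => [k _|k]; rewrite inE => /abD[abk [_ _ sk]].
    by rewrite lee_fin subr_ge0 ltW.
  by rewrite -EFinM lee_fin mulrC ler_pdivlMr// mulrC ltW.
rewrite nneseriesZl; last first.
  by move=> k; rewrite inE => /abD[abk _]; rewrite lee_fin subr_ge0; apply/fh/ltW.
rewrite mulrC EFinM lee_pmul2l ?lte_fin ?invr_gt0//.
by apply: lebesgue_increments => // k /abD[abk [? ? _]]; split=> //; split=> //; exact: ltW.
Qed.

(** Inside any open [O] containing [E], almost all of [E] is covered by disjoint
shallow intervals, on which [f] increases in total by at most [u] times the
length of [O]; by the previous lemma, applied in each of them, the measure of [E] is then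
at most [u / v] times that of [O]. As [O] may have nearly the measure of [E]
and [u < v], the set [E] is null. *)
Lemma lebesgue_oscillating f u v l r (E : set R) :
    {homo f : x y / x <= y} -> 0 < u < v -> l <= r -> E `<=` `]l, r[ ->
    (forall x, E x -> finely_straddled (shallow f u) x) ->
    (forall x, E x -> finely_straddled (steep f v) x) ->
  leb E = 0%E.
Proof.
move=> fh /andP[u0 uv] lr Elr Eu Ev.
have v0 : 0 < v by exact: lt_trans uv.
have key (O : set R) : open O -> E `<=` O -> (leb E <= (u / v)%:E * leb O)%E.
  move=> oO EO.
  have [x Ex e e0|a [b [D [abD tD E0]]]] := @vitali_rat_intervals E
      (fun a b => `[a, b]%classic `<=` O /\ shallow f u a b).
    have [d /= d0 dO] := open_subball oO (EO _ Ex).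
    have e'0 : 0 < Num.min e (d / 2) by rewrite lt_min e0 divr_gt0.
    have [p [q [/andP[px xq] + Ppq]]] := shallow_rat fh u0 (Eu x Ex) e'0.
    rewrite lt_min => /andP[pqe pqd].
    exists p, q; split; [exact/andP | by [] | split=> // y /=].
    rewrite in_itv/= => /andP[py yq].
    apply: (dO (d / 2)) => //=.
    - by rewrite sub0r normrN gtr0_norm ?divr_gt0//; lra.
    - by rewrite divr_gt0.
    - by rewrite /ball/= ltr_norml; apply/andP; split; lra.
  have bO : \bigcup_(k in D) `[a k, b k]%classic `<=` O.
    by move=> x [k /abD[_ [abO _]]] /abO.
  apply: (@le_trans _ _ ((u / v)%:E * leb (\bigcup_(k in D) `[a k, b k]%classic))%E); last first.
    by rewrite lee_pmul2l ?lte_fin ?divr_gt0// le_outer_measure.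
  have -> : leb (\bigcup_(k in D) `[a k, b k]%classic) =
      (\sum_(k <oo | k \in D) (b k - a k)%:E)%E.
    by apply: leb_bigcup_itv => // k /abD[].
  rewrite -nneseriesZl; last first.
    by move=> k; rewrite inE => /abD[abk _]; rewrite lee_fin subr_ge0 ltW.
  apply: (@le_trans _ _ (leb (\bigcup_(k in D) (E `&` `[a k, b k]%classic)))).
    by apply: (le_trans (outer_measure_diff0 E0)); rewrite setI_bigcupr.
  rewrite bigcup_mkcond eseries_mkcond.
  apply: (le_trans (outer_measure_sigma_subadditive _ _)).
  apply: lee_nneseries => [k _ _|k _]; first exact: outer_measure_ge0.
  case: ifPn => [|_]; last by rewrite outer_measure0.
  rewrite inE => /abD[abk [_ sk]].
  have Eab : E `&` `[a k, b k]%classic `<=`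
      (E `&` `]a k, b k[%classic) `|` ([set a k] `|` [set b k]).
    move=> x [Ex] /=; rewrite !in_itv/= => /andP[ax xb].
    move: ax xb; rewrite !le_eqVlt => /orP[/eqP->|ax]; first by right; left.
    by move=> /orP[/eqP->|xb]; [right; right|left; split=> //; exact/andP].
  apply: (le_trans (le_outer_measure _ _ _ Eab)).
  apply: (le_trans (outer_measureU2 _ _ _)).
  have -> : leb ([set a k] `|` [set b k]) = 0%E.
    apply/eqP; rewrite eq_le outer_measure_ge0 andbT.
    apply: (le_trans (outer_measureU2 _ _ _)).
    have s1 x : leb [set x] = 0%E by exact: (lebesgue_measure_set1 x).
    by rewrite !s1 adde0.
  rewrite adde0.
  apply: (le_trans (lebesgue_steep fh v0 (ltW abk) (@subIsetr _ _ _) _)).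
    by move=> x [/Ev].
  rewrite -EFinM lee_fin ler_pdivrMr//.
  rewrite (_ : _ * _ * v = u * (b k - a k)); first exact: ltW.
  by field; rewrite gt_eqF.
have Efin : leb E \is a fin_num.
  rewrite ge0_fin_numE ?outer_measure_ge0//.
  apply: (le_lt_trans (le_outer_measure _ _ _ Elr)).
  by rewrite -[ltLHS]/(lebesgue_measure _) lebesgue_measure_itv; case: ifP; rewrite ?ltry.
have := outer_measure_ge0 leb E.
rewrite -(fineK Efin) lee_fin => x0; congr (_%:E).
apply/eqP; rewrite eq_le x0 andbT leNgt; apply/negP => {}x0.
set x := fine _ in x0.
(* so that [u / v * (x + e) < x] *)
pose e := x * (v - u) / (2 * u).
have e0 : 0 < e by rewrite divr_gt0 ?mulr_gt0 ?subr_gt0.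
have [V [oO EO Oe]] := outer_measure_open_le E e0.
have {}Oe : (leb V <= (x + e)%:E)%E by rewrite EFinD /x fineK.
have uv0 : 0 <= u / v by rewrite divr_ge0 ?ltW.
have := le_trans (key V oO EO) (lee_wpmul2l (_ : (0 <= (u / v)%:E)%E) Oe).
rewrite -EFinM -(fineK Efin) -/x !lee_fin => /(_ uv0).
have -> : u / v * (x + e) = x - x * (v - u) / (2 * v).
  by rewrite /e; field; rewrite !gt_eqF.
have : 0 < x * (v - u) / (2 * v) by rewrite divr_gt0 ?mulr_gt0 ?subr_gt0.
lra.
Qed.

Lemma lebesgue_infinitely_steep f l r (E : set R) :
    {homo f : x y / x <= y} -> l <= r -> E `<=` `]l, r[ ->
    (forall x v, E x -> 0 < v -> finely_straddled (steep f v) x) ->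
  leb E = 0%E.
Proof.
move=> fh lr Elr Ev; apply/eqP; rewrite eq_le outer_measure_ge0 andbT.
apply/lee_addgt0Pr => e e0; rewrite add0e.
pose v := (f r - f l + 1) / e.
have := fh _ _ lr => flr.
have v0 : 0 < v by rewrite divr_gt0//; lra.
apply: (le_trans (lebesgue_steep fh v0 lr Elr (fun x Ex => Ev x v Ex v0))).
rewrite lee_fin ler_pdivrMr// /v mulrC mulfVK ?gt_eqF//; lra.
Qed.

(** If the slopes over straddling intervals converge to [L], so do those over
intervals ending at [x]: the upper bound extends by pushing both endpoints
outwards, and the lower bound follows by subtracting a small interval on the
other side of [x], where the upper bound applies. *)
Lemma straddle_derivable (f : R -> R) (x L : R) : {homo f : x y / x <= y} ->
  (forall e, 0 < e -> exists2 d, 0 < d & forall a b, a < x < b -> b - a < d ->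
     (L - e) * (b - a) <= f b - f a <= (L + e) * (b - a)) ->
  derivable f x 1.
Proof.
move=> fh fL; apply/cvg_ex; exists L; apply/cvgrPdist_le => e e0.
have [d d0 fd] := fL e e0.
have upr (a b : R) : a <= x <= b -> b - a < d -> f b - f a <= (L + e) * (b - a).
  move=> /andP[ax xb] bad; rewrite leNgt; apply/negP => c.
  pose t := Num.min ((d - (b - a)) / 4)
    ((f b - f a - (L + e) * (b - a)) / (4 * (`|L + e| + 1))).
  have K0 : 0 < 4 * (`|L + e| + 1) by rewrite mulr_gt0 ?ltr_wpDl.
  have t0 : 0 < t by rewrite lt_min !divr_gt0 ?subr_gt0.
  have td : t <= (d - (b - a)) / 4 by rewrite ge_min lexx.
  have tv : t * (4 * (`|L + e| + 1)) <= f b - f a - (L + e) * (b - a).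
    by rewrite -ler_pdivlMr ?mulr_gt0// ge_min lexx orbT.
  have /fh fa : a - t <= a by lra.
  have /fh fb : b <= b + t by lra.
  have xt : a - t < x < b + t by apply/andP; split; lra.
  have dt : b + t - (a - t) < d by lra.
  have /andP[_] := fd _ _ xt dt.
  have : t * (L + e) <= t * `|L + e| by rewrite ler_pM2l// ler_norm.
  have : 0 <= t * `|L + e| by rewrite mulr_ge0// ltW.
  by lra.
have lor (a b : R) : a <= x <= b -> (a == x) || (b == x) -> b - a < d ->
    (L - e) * (b - a) <= f b - f a.
  move=> /andP[ax xb] axb bad; rewrite leNgt; apply/negP => c.
  have ab : a < b.
    rewrite lt_neqAle (le_trans ax xb) andbT; apply/eqP => abE.
    by move: c; rewrite abE !subrr mulr0 ltxx.
  pose t := Num.min ((d - (b - a)) / 2) (((L - e) * (b - a) - (f b - f a)) / (4 * e)).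
  have t0 : 0 < t by rewrite lt_min !divr_gt0 ?subr_gt0 ?mulr_gt0.
  have td : t <= (d - (b - a)) / 2 by rewrite ge_min lexx.
  have tv : t * (4 * e) <= (L - e) * (b - a) - (f b - f a).
    by rewrite -ler_pdivlMr ?mulr_gt0// ge_min lexx orbT.
  have te : 0 < t * e by rewrite mulr_gt0.
  case/orP: axb => /eqP E; [rewrite {}E in ab ax c bad td tv *|rewrite {}E in ab xb c bad td tv *].
    have xt : x - t < x < b by apply/andP; split; lra.
    have dt : b - (x - t) < d by lra.
    have xt' : x - t <= x <= x by apply/andP; split; lra.
    have dt' : x - (x - t) < d by lra.
    have /andP[+ _] := fd _ _ xt dt.
    have := upr _ _ xt' dt'.
    by lra.
  have xt : a < x < x + t by apply/andP; split; lra.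
  have dt : x + t - a < d by lra.
  have xt' : x <= x <= x + t by apply/andP; split; lra.
  have dt' : x + t - x < d by lra.
  have /andP[+ _] := fd _ _ xt dt.
  have := upr _ _ xt' dt'.
  by lra.
have hdn : \forall h \near 0^', `|h : R| < d.
  apply: nbhs_dnbhs; apply/nbhs_ballP; exists d => //= h.
  by rewrite /ball/= sub0r normrN.
near=> h.
have h0 : h != 0 by near: h; exact: nbhs_dnbhs_neq.
have : `|h| < d by near: h; exact: hdn.
rewrite distrC ler_distl /= /shift/= [h *: 1]mulr1 -[_ *: _]/(_ * _) [h + x]addrC.
case: (ltgtP h 0) h0 => // h0 _ hd.
  have /andP[xh1 xh2] : x + h <= x <= x by apply/andP; split; lra.
  have {}hd : x - (x + h) < d by rewrite ltr0_norm// in hd; lra.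
  have A1 := upr (x + h) x (introT andP (conj xh1 xh2)) hd.
  have A2 := lor (x + h) x (introT andP (conj xh1 xh2)) (introT orP (or_intror (eqxx x))) hd.
  by rewrite ler_ndivlMl// ler_ndivrMl//; apply/andP; split; lra.
have /andP[xh1 xh2] : x <= x <= x + h by apply/andP; split; lra.
have {}hd : x + h - x < d by rewrite gtr0_norm// in hd; lra.
have A1 := upr x (x + h) (introT andP (conj xh1 xh2)) hd.
have A2 := lor x (x + h) (introT andP (conj xh1 xh2)) (introT orP (or_introl (eqxx x))) hd.
by rewrite ler_pdivlMl// ler_pdivrMl//; apply/andP; split; lra.
Unshelve. all: by end_near.
Qed.

Lemma negligible_bigcup_countable (I : countType) (F : I -> set R) :
  (forall i, lebesgue_measure.-negligible (F i)) ->
  lebesgue_measure.-negligible (\bigcup_i F i).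
Proof.
move=> F0; pose G k := if unpickle k is Some i then F i else set0.
have G0 : lebesgue_measure.-negligible (\bigcup_k G k).
  by apply: negligible_bigcup => k; rewrite /G; case: unpickle => //; exact: negligible_set0.
apply: negligibleS G0 => x [i _ Fx].
by exists (pickle i) => //; rewrite /G pickleK.
Qed.

(** Lebesgue's theorem. Outside the null sets [Ninf] and [Nosc], the slopes over
the small intervals straddling [x] are bounded, and no two rationals [u < v]
separate their lower and upper limits. *)
Lemma nondecreasing_ae_derivable (f : R -> R) : {homo f : x y / x <= y} ->
  {ae (@lebesgue_measure R), forall x, derivable f x 1}.
Proof.
move=> fh.
(* The exceptional sets are cut by the bounded intervals [J K], as the
   measure estimates require. *)
pose J (K : nat) : set R := `] - K%:R, K%:R[%classic.
pose Ninf K := [set x | J K x /\ forall v, 0 < v -> finely_straddled (steep f v) x].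
pose Nosc (K : nat) (u v : rat) := [set x | [/\ J K x,
  finely_straddled (shallow f (ratr u)) x & finely_straddled (steep f (ratr v)) x]].
pose N := (\bigcup_K Ninf K) `|`
  \bigcup_K \bigcup_(uv : rat * rat) (if 0 < uv.1 < uv.2 then Nosc K uv.1 uv.2 else set0).
have KK (K : nat) : - K%:R <= K%:R :> R by rewrite lerNl (le_trans (_ : - K%:R <= 0)) ?oppr_le0.
have N0 : lebesgue_measure.-negligible N.
  apply: negligibleU; apply: negligible_bigcup => K.
    apply/negligible_outer_measure.
    apply: (lebesgue_infinitely_steep fh (KK K)) => [x []//|x v []] _; exact.
  apply: negligible_bigcup_countable => -[u v]/=; case: ifPn => [|_]; last exact: negligible_set0.
  move=> /andP[u0 uv]; apply/negligible_outer_measure.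
  apply: (lebesgue_oscillating fh (u := ratr u) (v := ratr v) _ (KK K)).
  - by rewrite ltr0q u0 ltr_rat.
  - by move=> x [].
  - by move=> x [].
  - by move=> x [].
apply: negligibleS N0.
move=> x /= ndx; apply: contrapT => Nx; apply: ndx.
have [K JK] : exists K, J K x.
  exists (Num.truncn `|x|).+1.
  have := truncnS_gt `|x|; rewrite /J/= in_itv/= ltr_norml; exact.
have bdd : exists2 v, 0 < v & ~ finely_straddled (steep f v) x.
  apply: contrapT => h; apply: Nx; left; exists K => //; split=> // v v0.
  by apply: contrapT => fv; apply: h; exists v.
have osc (u v : rat) : 0 < u < v -> ~ finely_straddled (shallow f (ratr u)) x \/
    ~ finely_straddled (steep f (ratr v)) x.
  move=> uv; apply/not_andP => -[fu fv]; apply: Nx; right; exists K => //.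
  by exists (u, v) => //=; rewrite uv.
have nfs P : ~ finely_straddled P x -> exists2 d, 0 < d & forall a b, a < x < b -> b - a < d -> ~ P a b.
  move=> nP; apply: contrapT => h; apply: nP => e e0; apply: contrapT => h'.
  apply: h; exists e => // a b axb be Pab; apply: h'; by exists a, b.
(* [inf S] is the upper limit of the slopes, shown to be also the lower
   limit *)
pose S := [set s | exists2 d, 0 < d & forall a b, a < x < b -> b - a < d ->
  f b - f a <= s * (b - a)].
have S0 : lbound S 0.
  move=> s [d d0 sd]; rewrite leNgt; apply/negP => s0.
  have xd : x - d / 4 < x < x + d / 4 by apply/andP; split; lra.
  have dd : x + d / 4 - (x - d / 4) < d by lra.
  have := sd _ _ xd dd.
  have /fh : x - d / 4 <= x + d / 4 by lra.
  have : 0 < (- s) * d by rewrite mulr_gt0// oppr_gt0.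
  by lra.
have hS : has_inf S.
  split; last by exists 0.
  have [v v0 /nfs[d d0 dP]] := bdd; exists v, d => // a b axb bad.
  by rewrite leNgt; apply/negP; exact: dP.
pose L := inf S.
have L0 : 0 <= L by exact: lb_le_inf hS.1 S0.
apply: (@straddle_derivable f x L fh) => e e0.
have [s [d1 d10 sd1] sL] := inf_adherent e0 hS.
have [d2 d20 sd2] : exists2 d, 0 < d & forall a b, a < x < b -> b - a < d ->
    (L - e) * (b - a) <= f b - f a.
  have [Le|Le] := leP (L - e) 0.
    exists 1 => // a b /andP[ax xb] _.
    have ab : a <= b by lra.
    apply: (@le_trans _ _ 0); first by rewrite mulr_le0_ge0// subr_ge0.
    by rewrite subr_ge0 fh.
  have /rat_in_itvoo[u] : L - e < L - e / 2 by lra.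
  have /rat_in_itvoo[v] : L - e / 2 < L by lra.
  rewrite !in_itv/= => /andP[ev vL] /andP[eu ue].
  have uv : 0 < u < v by rewrite -(ltr0q R) -(ltr_rat R); apply/andP; split; lra.
  have [/nfs[d d0 dP]|/nfs[d d0 dP]] := osc u v uv.
    exists d => // a b axb bad; have := dP a b axb bad; rewrite /shallow => /negP.
    rewrite -leNgt; apply: le_trans; rewrite ler_wpM2r//; last exact: ltW.
    by move: axb => /andP[? ?]; lra.
  exfalso; have : S (ratr v).
    by exists d => // a b axb bad; rewrite leNgt; apply/negP; exact: dP.
  by move=> /(ge_inf hS.2); rewrite -/L; lra.
exists (Num.min d1 d2); first by rewrite lt_min d10.
move=> a b axb; rewrite lt_min => /andP[bd1 bd2]; rewrite sd2//=.
apply: (le_trans (sd1 a b axb bd1)); rewrite ler_wpM2r//; last exact: ltW.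
by move: axb => /andP[? ?]; lra.
Qed.

End monotone_derivable.

(** * The distribution of distances in a part of the sphere *)

Section distance_distribution.
Set Implicit Arguments.
Unset Strict Implicit.
Context {R : realType} {n : nat}.
Local Notation E := (n_area_space R n).
Local Notation mu := (n_area R n).
Local Notation S := (@sphere R n : set E).

Definition closer (l : R) : set (E * E) := [set xy | dE xy.1 xy.2 < l].

(** Measurability refers here to the Caratheodory sigma-algebra, whose
relation with the topology is provided by [caratheodory_lipschitz]. *)
Lemma measurable_coordinate i : measurable_fun setT (fun x : E => (x : 'rV[R]_n.+1) ord0 i).
Proof.
move=> _; apply: (measurability _ (RGenInftyO.measurableE R)) => //.
move=> _ [_ [r ->] <-]; rewrite setTI.
have := @caratheodory_lipschitz R _ (@dE R n.+1) n (fun x => x ord0 i) r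
  (fun x y => dE_coord x y i).
by congr caratheodory_measurable; apply/seteqP; split=> x /=; rewrite in_itv.
Qed.

Lemma measurable_closer l : measurable (closer l).
Proof.
have [l0|l0] := ltP 0 l; last first.
  rewrite (_ : closer l = set0)//; apply/seteqP; split=> // xy /=.
  by rewrite /closer/= dE_lt ltNge l0.
pose f (xy : E * E) : R := \sum_(i < n.+1) ((xy.1 : 'rV[R]_n.+1) ord0 i - (xy.2 : 'rV[R]_n.+1) ord0 i) ^+ 2.
have mf : measurable_fun setT f.
  apply: measurable_sum => i; apply: measurable_funX; apply: measurable_funB.
    exact: (measurableT_comp (measurable_coordinate i) measurable_fst).
  exact: (measurableT_comp (measurable_coordinate i) measurable_snd).
have := measurable_fun_ltr mf (measurable_cst (l ^+ 2)) measurableT.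
move=> /(_ [set true] I); rewrite setTI; congr measurable.
by apply/seteqP; split=> xy /=; rewrite /closer/= dE_lt l0.
Qed.

Lemma cumulative_distanceE (A : set E) l : measurable A ->
  cumulative_distance A l = (\int[mu]_(x in A) mu (A `&` xsection (closer l) x))%E.
Proof.
move=> mA; apply: eq_integral => x _.
have mx : measurable (xsection (closer l) x).
  by apply: measurable_xsection; exact: measurable_closer.
rewrite setIC -integral_indic//.
apply: eq_integral => y _; rewrite /heaviside subr_gt0 indicE.
have -> : (y \in xsection (closer l) x) = (dE x y < l).
  by rewrite mem_xsection; apply/idP/idP; rewrite inE.
by case: ifP.
Qed.

Section partition.
Variables (A A' : set E).
Hypothesis AA' : sphere_partition A A'.

Let mA : measurable A. Proof. by case: AA'. Qed.
Let mA' : measurable A'. Proof. by case: AA'. Qed.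
Let AUA' : A `|` A' = S. Proof. by case: AA'. Qed.
Let AIA' : A `&` A' = set0. Proof. by case: AA'. Qed.
Let mS : measurable S. Proof. by rewrite -AUA'; exact: measurableU. Qed.
Let AS : A `<=` S. Proof. by rewrite -AUA'; exact: subsetUl. Qed.
Let A'S : A' `<=` S. Proof. by rewrite -AUA'; exact: subsetUr. Qed.

Lemma sphere_subset_area_fin (B : set E) : B `<=` S -> mu B \is a fin_num.
Proof.
move=> BS; rewrite ge0_fin_numE ?measure_ge0//.
exact: le_lt_trans (le_hausdorff _ _ BS) (@hausdorff_sphere_fin R n).
Qed.

(** The key identity. Its right-hand side involves the partition only through
the difference of the two areas. *)
Lemma fine_cumulative_distance_diff (x0 : E) l : S x0 ->
  fine (cumulative_distance A l) - fine (cumulative_distance A' l) =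
  (fine (mu A) - fine (mu A')) * fine (mu (S `&` xsection (closer l) x0)).
Proof.
move=> Sx0; rewrite !cumulative_distanceE//.
apply: (@integral_measure_xsection_diff _ _ _ _ S) => //.
- exact: hausdorff_sphere_fin.
- exact: measurable_closer.
- by move=> x y; rewrite /closer/= dE_sym.
- by apply: sphere_subset_area_fin; exact: subIsetl.
- move=> x Sx.
  have capE z : S `&` xsection (closer l) z = S `&` [set y | dE z y < l].
    by apply/seteqP; split=> y; rewrite /xsection/closer/= inE.
  by rewrite !capE; exact: sphere_cap.
Qed.

Lemma fine_cumulative_distance_homo :
  {homo (fun l => fine (cumulative_distance A l)) : x y / x <= y}.
Proof.
move=> l l' ll'; have fin t : cumulative_distance A t \is a fin_num.
  rewrite cumulative_distanceE//; apply: (@integral_measure_xsection_fin _ _ _ _ S) => //.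
  - exact: hausdorff_sphere_fin.
  - exact: measurable_closer.
apply: fine_le; [exact: fin|exact: fin|].
rewrite (cumulative_distanceE l mA) (cumulative_distanceE l' mA).
apply: (@le_integral_measure_xsection _ _ _ _ S).
- exact: mS.
- exact: hausdorff_sphere_fin.
- exact: measurable_closer.
- exact: measurable_closer.
- by move=> xy /lt_le_trans; apply.
- exact: mA.
- exact: AS.
Qed.

End partition.
End distance_distribution.

Lemma derive1_diff_eq (R : realType) (f f' g g' : R -> R) (l : R) :
    (forall t, f t - f' t = g t - g' t) -> derivable f l 1 -> derivable f' l 1 ->
    derivable g l 1 -> derivable g' l 1 ->
  derive1 f l - derive1 f' l = derive1 g l - derive1 g' l.
Proof.
move=> fg df df' dg dg'.
rewrite (derive1E f) (derive1E f') (derive1E g) (derive1E g').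
rewrite -(deriveB df df') -(deriveB dg dg').
by congr ('D_1 _ l); apply/funext => t; exact: fg.
Qed.

Theorem mainTheorem1 (R : realType) (n : nat) (hn : (1 <= n)%N)
    (A A' B B' : set (n_area_space R n))
    (hA : sphere_partition A A') (hB : sphere_partition B B')
    (hAB : (n_area R n A - n_area R n A' = n_area R n B - n_area R n B')%E) :
  {ae (@lebesgue_measure R), forall l : R,
    `|distance_density A l - distance_density A' l| =
    `|distance_density B l - distance_density B' l|}.
Proof.
have symP (C C' : set (n_area_space R n)) :
    sphere_partition C C' -> sphere_partition C' C.
  by case=> mC mC' CUC' CIC'; split; rewrite // 1?setUC 1?setIC.
have subS (C C' : set (n_area_space R n)) : sphere_partition C C' -> C `<=` @sphere R n.
  by case=> _ _ <- _; exact: subsetUl.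
have fin (C C' : set (n_area_space R n)) : sphere_partition C C' -> n_area R n C \is a fin_num.
  by move=> /subS; exact: sphere_subset_area_fin.
pose x0 : 'rV[R]_n.+1 := delta_mx ord0 ord0.
have Sx0 : sphere x0.
  apply/sphereE; rewrite big_ord_recl big1 => [|i _]; rewrite /x0 mxE ?eqxx/= ?expr1n ?addr0//.
  by rewrite expr0n.
have area : fine (n_area R n A) - fine (n_area R n A') =
    fine (n_area R n B) - fine (n_area R n B').
  rewrite -!fineB ?hAB//; by [exact: fin hA|exact: fin (symP _ _ hA)|exact: fin hB|exact: fin (symP _ _ hB)].
pose F (C : set (n_area_space R n)) l := fine (cumulative_distance C l).
have FAB l : F A l - F A' l = F B l - F B' l.
  rewrite [LHS](fine_cumulative_distance_diff hA l Sx0).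
  by rewrite [RHS](fine_cumulative_distance_diff hB l Sx0) area.
have dF C C' : sphere_partition C C' ->
    {ae (@lebesgue_measure R), forall l : R, derivable (F C) l 1}.
  by move=> h; exact/nondecreasing_ae_derivable/(fine_cumulative_distance_homo h).
have dFA := dF _ _ hA; have dFA' := dF _ _ (symP _ _ hA).
have dFB := dF _ _ hB; have dFB' := dF _ _ (symP _ _ hB).
have ae_filter := ae_filter_ringOfSetsType (@lebesgue_measure R).
apply: (filterS2 ae_filter _ (filterI dFA dFA') (filterI dFB dFB')).
move=> l [dA dA'] [dB dB'].
have E := derive1_diff_eq FAB dA dA' dB dB'.
exact: (congr1 (fun z : R => `|z|) E).
Qed.
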